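(* Let $\varphi: A\to B$ be a flat local morphism of Noetherian local rings with $\operatorname{edim}(A)\ge\operatorname{edim}(B)$, and let $M$ be a $B$-module of finite type that is free over $A$. Then $M$ is free over $B$ and $\operatorname{edim}(A)=\operatorname{edim}(B)$.
   Context: For a Noetherian local ring $A$, $\operatorname{edim}(A)$ is its embedding dimension, i.e. the minimal number of generators of its maximal ideal. $M$ is regarded as an $A$-module via $\varphi$. *)

(* Defs.v *)
From HB Require Import structures.
From mathcomp Require Import all_boot all_algebra.
From mathcomp Require Import boolp classical_sets.
From mathcomp Require Import freeg.

Set Implicit Arguments.
Unset Strict Implicit.
Unset Printing Implicit Defensive.

Import GRing.Theory.
Local Open Scope ring_scope.
Local Open Scope quotient_scope.

Section Modules.
Variables (R : comNzRingType) (M : lmodType R).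

Definition lin_comb (s : seq M) (c : 'I_(size s) -> R) : M :=
  \sum_(i < size s) c i *: s`_i.

Definition generates (s : seq M) (I : {pred M}) : Prop :=
  forall x, x \in I <-> exists c, x = @lin_comb s c.

Definition finite_type : Prop := exists s, generates s predT.

(* [X] is a possibly infinite basis. *)
Definition module_basis (X : set M) : Prop :=
  (forall x, exists s c, {in s, forall y, X y} /\ x = @lin_comb s c) /\
  (forall s c, uniq s -> {in s, forall y, X y} ->
     @lin_comb s c = 0 -> forall i, c i = 0).

Definition free_module : Prop := exists X, module_basis X.

End Modules.

Section LocalRings.
Variable R : comNzRingType.

(* Ideals are submodules of [R^o]; unlike [idealr_closed], [submod_closed]
   allows the unit ideal. *)
Definition noetherian : Prop :=
  forall I : {pred R^o}, submod_closed I -> exists s, generates s I.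

Definition maximal_ideal (m : {pred R}) : Prop :=
  idealr_closed m /\
  forall J : {pred R}, idealr_closed J -> {subset m <= J} -> {subset J <= m}.

Definition local_ring : Prop := exists! m : {pred R}, maximal_ideal m.

(* Meaningful when [local_ring] holds. *)
Definition max_ideal : {pred R} :=
  xget (xpred0 : R -> bool) [set m : R -> bool | maximal_ideal m].

(* Meaningful when [R] is local and Noetherian, so that a finite generating
   sequence exists. *)
Definition edim : nat :=
  xget 0%N [set n |
    (exists2 s : seq R^o, generates s max_ideal & size s = n) /\
    (forall s : seq R^o, generates s max_ideal -> (n <= size s)%N)].

Lemma max_idealP : local_ring -> maximal_ideal max_ideal.
Proof. by case=> m [mP _]; apply: (xgetPex (xpred0 : R -> bool)); exists m. Qed.

Lemma edimP : noetherian -> local_ring ->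
  (exists2 s : seq R^o, generates s max_ideal & size s = edim) /\
  (forall s : seq R^o, generates s max_ideal -> (edim <= size s)%N).
Proof.
move=> nR /max_idealP[[m0 _ mD] _].
apply: (@xgetPex _ 0%N [set n | (exists2 s : seq R^o,
  generates s max_ideal & size s = n) /\ forall s : seq R^o,
  generates s max_ideal -> (n <= size s)%N]).
pose p n := `[< exists2 s : seq R^o, generates s max_ideal & size s = n >].
have [|s sP] := nR max_ideal; first by split=> // a x y; apply: mD.
have ex_p : exists n, p n by exists (size s); apply/asboolP; exists s.
have [n /asboolP n_gen n_min] := ex_minnP ex_p.
by exists n; split=> // t tP; apply/n_min/asboolP; exists t.
Qed.

End LocalRings.

Arguments noetherian R : clear implicits.
Arguments maximal_ideal {R} m.
Arguments local_ring R : clear implicits.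
Arguments max_ideal R : clear implicits.
Arguments edim R : clear implicits.

Definition local_morphism (A B : comNzRingType) (phi : {rmorphism A -> B}) :
  Prop := forall a, a \in max_ideal A -> phi a \in max_ideal B.

(* The [B]-module [M], viewed as an [A]-module through [phi]. *)
Definition restrict (A B : comNzRingType) (phi : {rmorphism A -> B})
  (M : lmodType B) : Type := M.

Section Restrict.
Variables (A B : comNzRingType) (phi : {rmorphism A -> B}) (M : lmodType B).

HB.instance Definition _ := GRing.Zmodule.on (restrict phi M).

Definition restrict_scale (a : A) (x : restrict phi M) : restrict phi M :=
  phi a *: (x : M).

Lemma restrict_scaleA a b x :
  restrict_scale a (restrict_scale b x) = restrict_scale (a * b) x.
Proof. by rewrite /restrict_scale scalerA rmorphM. Qed.

Lemma restrict_scale1 : left_id 1 restrict_scale.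
Proof. by move=> x; rewrite /restrict_scale rmorph1 scale1r. Qed.

Lemma restrict_scaleDr : right_distributive restrict_scale +%R.
Proof. by move=> a x y; rewrite /restrict_scale scalerDr. Qed.

Lemma restrict_scaleDl x : {morph restrict_scale^~ x : a b / a + b}.
Proof. by move=> a b; rewrite /restrict_scale rmorphD scalerDl. Qed.

HB.instance Definition _ := GRing.Zmodule_isLmodule.Build A (restrict phi M)
  restrict_scaleA restrict_scale1 restrict_scaleDr restrict_scaleDl.

End Restrict.

Section Tensor.
Variables (R : comNzRingType) (M N : lmodType R).

Local Notation F := {freeg (M * N)%type / int}.

Definition tensor_relations (S : {pred F}) : Prop :=
  [/\ forall x x' y, << (x + x', y) >> - << (x, y) >> - << (x', y) >> \in S,
      forall x y y', << (x, y + y') >> - << (x, y) >> - << (x, y') >> \in S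
    & forall a x y, << (a *: x, y) >> - << (x, a *: y) >> \in S].

Definition tensor_kernel : {pred F} := fun z =>
  `[< forall S : {pred F}, zmod_closed S -> tensor_relations S -> z \in S >].

Lemma tensor_kernel_closed : zmod_closed tensor_kernel.
Proof.
split=> [|x y /asboolP hx /asboolP hy]; apply/asboolP=> S cS rS.
  by case: cS.
by apply: (proj2 cS); [apply: hx | apply: hy].
Qed.

HB.instance Definition _ :=
  GRing.isZmodClosed.Build F tensor_kernel tensor_kernel_closed.

(* The tensor product of [M] and [N] over [R], as an abelian group: the free
   abelian group on [M * N] modulo the subgroup [tensor_kernel]. *)
Definition tensor : zmodType := Quotient.quot tensor_kernel.

Definition tens (x : M) (y : N) : tensor := \pi_tensor << (x, y) >>.

Lemma tensor_kernel_rel : tensor_relations tensor_kernel.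
Proof.
by split=> *; apply/asboolP=> S _ [h1 h2 h3]; [apply: h1|apply: h2|apply: h3].
Qed.

Lemma tensor_eqP (z z' : F) :
  reflect (\pi_tensor z = \pi_tensor z') (z - z' \in tensor_kernel).
Proof. by rewrite (Quotient.idealrBE tensor_kernel); apply: eqP. Qed.

Section Lift.
Variables (P : zmodType) (f : M -> N -> P).

Definition balanced : Prop :=
  [/\ forall x x' y, f (x + x') y = f x y + f x' y,
      forall x y y', f x (y + y') = f x y + f x y'
    & forall a x y, f (a *: x) y = f x (a *: y)].

(* The additive map induced by [f] when [f] is [balanced]. *)
Definition tensor_lift (t : tensor) : P :=
  fglift (fun p => f p.1 p.2 : zmodule P) (repr t).

Hypothesis fP : balanced.

Lemma tensor_lift_pi z :
  tensor_lift (\pi_tensor z) = fglift (fun p => f p.1 p.2 : zmodule P) z.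
Proof.
have gB := lift_is_additive (fun p : (M * N)%type => f p.1 p.2 : zmodule P).
apply/subr0_eq; rewrite -gB; set g := fglift _ in gB *.
have : repr (\pi_tensor z) - z \in tensor_kernel.
  by apply/tensor_eqP; rewrite reprK.
have g1 x y : g << (x, y) >> = f x y by rewrite /g liftU scale1r.
have [f1 f2 f3] := fP.
move=> /asboolP /(_ (fun w => g w == 0)) h; apply/eqP; apply: h.
  split=> [|x y /eqP hx /eqP hy]; apply/eqP; last by rewrite gB hx hy subrr.
  by rewrite -(subrr 0) gB subrr.
split=> *; apply/eqP; rewrite !gB !g1.
- by rewrite f1 -addrA -opprD subrr.
- by rewrite f2 -addrA -opprD subrr.
- by rewrite f3 subrr.
Qed.

Lemma tensor_lift_is_additive : zmod_morphism tensor_lift.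
Proof.
move=> t t'; rewrite -[t]reprK -[t']reprK -raddfB !tensor_lift_pi.
exact: (lift_is_additive (fun p : (M * N)%type => f p.1 p.2 : zmodule P)).
Qed.

Lemma tensor_liftE x y : tensor_lift (tens x y) = f x y.
Proof. by rewrite tensor_lift_pi liftU scale1r. Qed.

Lemma tensor_lift_unique (g : {additive tensor -> P}) :
  (forall x y, g (tens x y) = f x y) -> g =1 tensor_lift.
Proof.
move=> gE t; rewrite -[t]reprK tensor_lift_pi.
have hB := lift_is_additive (fun p : (M * N)%type => f p.1 p.2 : zmodule P).
set h := fglift _ in hB *.
elim/freeg_ind_dom0: (repr t) => [|k [x y] z _ _ IH].
  by rewrite raddf0 raddf0; have := hB 0 0; rewrite !subrr => ->.
have hD a b : h (a + b) = h a + h b.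
  have h0 : h 0 = 0 by have := hB 0 0; rewrite !subrr.
  by rewrite -[b in LHS]opprK hB -[- b]sub0r hB h0 sub0r opprK.
rewrite raddfD raddfD IH hD; congr (_ + _).
rewrite /h liftU /= -[k in << k *g _ >>]intz -freegU_mulz raddfMz raddfMz.
by rewrite -/(tens x y) gE.
Qed.

End Lift.

Lemma tens_balanced : balanced tens.
Proof.
have [r1 r2 r3] := tensor_kernel_rel.
split=> *; rewrite /tens.
- by rewrite -raddfD; apply/tensor_eqP; rewrite opprD addrA.
- by rewrite -raddfD; apply/tensor_eqP; rewrite opprD addrA.
- exact/tensor_eqP.
Qed.

End Tensor.

Section Flat.
Variable R : comNzRingType.

(* [id_M (x) u], as a map of abelian groups. *)
Definition tensor_map (M N' N : lmodType R) (u : {linear N' -> N}) :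
  tensor M N' -> tensor M N := tensor_lift (fun x y => tens x (u y)).

Lemma tensor_mapE (M N' N : lmodType R) (u : {linear N' -> N}) x y :
  tensor_map u (tens x y) = tens x (u y) :> tensor M N.
Proof.
have [t1 t2 t3] := tens_balanced M N.
by rewrite /tensor_map tensor_liftE //; split=> *; rewrite ?linearD ?linearZ.
Qed.

(* Right exactness of [M (x) -] is automatic, so exactness amounts to
   preserving injections. *)
Definition flat_module (M : lmodType R) : Prop :=
  forall (N' N : lmodType R) (u : {linear N' -> N}),
    injective u -> injective (tensor_map (M := M) u).

End Flat.

(* [B^o] is [B] as a module over itself. *)
Definition flat_morphism (A B : comNzRingType) (phi : {rmorphism A -> B}) :
  Prop := flat_module (restrict phi B^o).

(* Main.v *)
(* Let x_1..x_n minimally generate the maximal ideal of A, let y_1..y_m, with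
   m <= n, generate that of B, write x_i = sum_j W_ij y_j, and put
   f_i = sum_j W_ij e_j in the Koszul complex of y, so that d f_i = x_i.
   Suppose that N is a B-module in which a relation sum_i x_i u_i = 0 forces
   u_i in (x) N, as A-flatness of N ensures.  If f_1 ... f_n z lies in (x) N,
   then z lies in (y) N: starting from f_1 ... f_n z and applying d, one gets
   rid of the f_i one at a time, modulo boundaries and (x).
   - For N = B, z = 1 and m < n, the product f_1 ... f_n z vanishes for degree
     reasons, so 1 would be in the maximal ideal; hence m = n.
   - For N the kernel of a minimal presentation B^d -> M, every z in N lies in
     (y) B^d.  As y_j f_1 ... f_n v = d (e_j f_1 ... f_n v) +- e_j d (f_1 ... f_n v)
     and the first term vanishes for degree reasons, f_1 ... f_n z lies in
     (x) B^d, hence in (x) N since M is A-flat.  Thus N = (y) N and N = 0 by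
     Nakayama. *)
Require Import Defs.
From HB Require Import structures.
From mathcomp Require Import all_boot all_algebra.
From mathcomp Require Import boolp classical_sets.

Set Implicit Arguments.
Unset Strict Implicit.
Unset Printing Implicit Defensive.

Import GRing.Theory.
Local Open Scope ring_scope.
Local Open Scope quotient_scope.

(** For a submodule [N] this is membership in the product (x) N. *)
Definition ideal_mul (R : nzRingType) (V : lmodType R) n (x : 'I_n -> R)
    (N : {pred V}) (v : V) : Prop :=
  exists2 u : 'I_n -> V, (forall i, u i \in N) & v = \sum_i x i *: u i.

(** * Koszul complex with coefficients in a module *)

Section Koszul.
Variables (B : comNzRingType) (V : lmodType B).
Implicit Types (al be : bitseq -> V) (s t : bitseq) (w y : seq B).

(* The Koszul complex of [y : seq B] with coefficients in [V] is encoded by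
   functions [bitseq -> V], of which only the values at words of length
   [size y] matter: [s] stands for the exterior product of the basis vectors
   flagged by [s].  Splitting off the first basis vector [e], an element reads
   [a + e b] with [a = al (false :: _)] and [b = al (true :: _)]. *)
Fixpoint wedge w al s : V :=
  match w, s with
  | c :: w', true :: t =>
      c *: al (false :: t) - wedge w' (fun u => al (true :: u)) t
  | _ :: w', false :: t => wedge w' (fun u => al (false :: u)) t
  | _, _ => 0
  end.

Fixpoint contr y al s : V :=
  match y, s with
  | _ :: y', true :: t => - contr y' (fun u => al (true :: u)) t
  | c :: y', false :: t =>
      contr y' (fun u => al (false :: u)) t + c *: al (true :: t)
  | _, _ => 0
  end.

Lemma eq_wedge w al be s : size s = size w ->
  (forall t, size t = size w -> al t = be t) -> wedge w al s = wedge w be s.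
Proof.
elim: w al be s => [|c w IH] al be [|[] s] //= [sz] eq_ab.
  rewrite eq_ab /= ?sz //; congr (_ - _).
  by apply: IH => // t tz; rewrite eq_ab /= ?tz.
by apply: IH => // t tz; rewrite eq_ab /= ?tz.
Qed.

Lemma eq_contr y al be s : size s = size y ->
  (forall t, size t = size y -> al t = be t) -> contr y al s = contr y be s.
Proof.
elim: y al be s => [|c y IH] al be [|[] s] //= [sz] eq_ab.
  by congr (- _); apply: IH => // t tz; rewrite eq_ab /= ?tz.
rewrite eq_ab /= ?sz //; congr (_ + _).
by apply: IH => // t tz; rewrite eq_ab /= ?tz.
Qed.

Lemma wedge_sum n (x : 'I_n -> B) (u : 'I_n -> bitseq -> V) w s :
  wedge w (fun t => \sum_i x i *: u i t) s = \sum_i x i *: wedge w (u i) s.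
Proof.
elim: w u s => [|c w IH] u [|[] s] /=;
  try by rewrite big1 // => i _; rewrite scaler0.
  rewrite IH scaler_sumr -sumrB; apply: eq_bigr => i _.
  by rewrite scalerBr !scalerA mulrC.
exact: IH.
Qed.

Lemma contr_sum n (x : 'I_n -> B) (u : 'I_n -> bitseq -> V) y s :
  contr y (fun t => \sum_i x i *: u i t) s = \sum_i x i *: contr y (u i) s.
Proof.
elim: y u s => [|c y IH] u [|[] s] /=;
  try by rewrite big1 // => i _; rewrite scaler0.
  by rewrite IH -sumrN; apply: eq_bigr => i _; rewrite scalerN.
rewrite IH scaler_sumr -big_split /=; apply: eq_bigr => i _.
by rewrite scalerDr !scalerA mulrC.
Qed.

Lemma contrD y al be s :
  contr y (fun t => al t + be t) s = contr y al s + contr y be s.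
Proof.
elim: y al be s => [|c y IH] al be [|[] s] /=; rewrite ?addr0 //.
  by rewrite IH opprD.
by rewrite IH scalerDr addrACA.
Qed.

Lemma contrN y al s : contr y (fun t => - al t) s = - contr y al s.
Proof.
elim: y al s => [|c y IH] al [|[] s] /=; rewrite ?oppr0 //; first by rewrite IH.
by rewrite IH scalerN opprD.
Qed.

Lemma contrZ y c al s : contr y (fun t => c *: al t) s = c *: contr y al s.
Proof.
elim: y al s => [|c' y IH] al [|[] s] /=; rewrite ?scaler0 //.
  by rewrite IH scalerN.
by rewrite IH scalerDr !scalerA mulrC.
Qed.

Lemma wedgeD w al be s :
  wedge w (fun t => al t + be t) s = wedge w al s + wedge w be s.
Proof.
elim: w al be s => [|c w IH] al be [|[] s] /=; rewrite ?addr0 //.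
by rewrite IH scalerDr opprD addrACA.
Qed.

Lemma wedgeZ w c al s : wedge w (fun t => c *: al t) s = c *: wedge w al s.
Proof.
elim: w al s => [|c' w IH] al [|[] s] /=; rewrite ?scaler0 //.
by rewrite IH scalerBr !scalerA mulrC.
Qed.

(** Contraction changes sign on passing the first basis vector, so the two orders of contracting
    cancel. *)
Lemma contrK y al s : contr y (contr y al) s = 0.
Proof.
elim: y al s => [|c y IH] al [|[] s] //=; first by rewrite contrN IH !oppr0.
by rewrite contrD contrZ IH add0r scalerN subrr.
Qed.

Lemma wedgeN w al s : wedge w (fun t => - al t) s = - wedge w al s.
Proof.
elim: w al s => [|c w IH] al [|[] s] /=; rewrite ?oppr0 //.
by rewrite IH scalerN opprD.
Qed.

(** Contraction is an antiderivation. Once the first basis vector is split off, the mixed terms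
    cancel and the product of the two leading coefficients is left. *)
Lemma contr_wedge y w al s : size w = size y -> size s = size y ->
  contr y (wedge w al) s + wedge w (contr y al) s =
  (\sum_(i < size y) w`_i * y`_i) *: al s.
Proof.
elim: y w al s => [|c y IH] [|d w] al [|[] s] //=.
- by rewrite big_ord0 scale0r addr0.
- move=> [zw] [zs]; rewrite big_ord_recl /= contrD contrN contrZ wedgeN.
  rewrite scalerDl -(IH w (fun u => al (true :: u))) //.
  by rewrite scalerDr scalerA opprD !opprK addrACA addKr.
- move=> [zw] [zs]; rewrite big_ord_recl /= wedgeD wedgeZ.
  rewrite scalerDl -(IH w (fun u => al (false :: u))) //.
  by rewrite scalerBr scalerA [c * d]mulrC addrACA subrK addrC.
Qed.

Lemma wedge_support w al k s : size s = size w ->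
  (forall t, size t = size w -> (count id t < k)%N -> al t = 0) ->
  (count id s < k.+1)%N -> wedge w al s = 0.
Proof.
elim: w al k s => [|c w IH] al k [|[] s] //= [zs] al0 ks.
  (* Behind a leading [true] one degree is already used. For k = 0 the truncation in [k.-1] is
     harmless, as the bound on the degree of the word is then absurd. *)
  rewrite al0 /= ?zs // scaler0 (IH _ k.-1) ?subr0 // => [t zt tk|].
    by rewrite al0 /= ?zt //; case: k tk {al0 ks}.
  by case: k ks {al0}.
by apply: (IH _ k) => // t zt tk; rewrite al0 /= ?zt.
Qed.

Definition unit_form m (j : 'I_m) : seq B := mkseq (fun i => (i == j)%:R) m.

Lemma unit_form_eval y (j : 'I_(size y)) :
  \sum_(i < size y) (unit_form j)`_i * y`_i = y`_j.
Proof.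
rewrite (bigD1 j) //= nth_mkseq // eqxx mul1r big1 ?addr0 // => i ij.
by rewrite nth_mkseq // (negbTE (ij : val i != j)) mul0r.
Qed.

Definition scalar_form (v : V) : bitseq -> V :=
  fun s => if has id s then 0 else v.

Lemma contr0 y s : contr y (fun=> 0) s = 0.
Proof.
by elim: y s => [|c y IH] [|[] s] //=; rewrite IH ?oppr0 // scaler0 addr0.
Qed.

Lemma contr_scalar_form y v s : contr y (scalar_form v) s = 0.
Proof.
elim: y s => [|c y IH] [|[] s] //=; first by rewrite contr0 oppr0.
by rewrite IH scaler0 addr0.
Qed.

Variables (n : nat) (x : 'I_n -> B) (W : 'I_n -> seq B) (y : seq B).
Hypothesis size_W : forall i, size (W i) = size y.
Hypothesis xE : forall i, x i = \sum_(j < size y) (W i)`_j * y`_j.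

Fixpoint wedges (l : seq 'I_n) (v : V) : bitseq -> V :=
  if l is i :: l' then wedge (W i) (wedges l' v) else scalar_form v.

(** The coefficient of x_j in d (f_l v), unfolded by d (f_i a) = x_i a - f_i (d a): a signed sum
    over the occurrences of j in [l], with that factor removed. *)
Fixpoint wedges_coef (l : seq 'I_n) (v : V) (j : 'I_n) : bitseq -> V :=
  if l is i :: l' then fun s =>
    (i == j)%:R *: wedges l' v s - wedge (W i) (wedges_coef l' v j) s
  else fun=> 0.

Lemma contr_wedges l v s : size s = size y ->
  contr y (wedges l v) s = \sum_i x i *: wedges_coef l v i s.
Proof.
elim: l s => [|i l IH] s zs /=.
  by rewrite contr_scalar_form big1 // => i _; rewrite scaler0.
rewrite -[LHS](addrK (wedge (W i) (contr y (wedges l v)) s)).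
rewrite contr_wedge ?size_W // -xE.
rewrite (@eq_wedge _ _ (fun t => \sum_j x j *: wedges_coef l v j t)).
- rewrite wedge_sum (bigD1 i) //= [RHS](bigD1 i) //= eqxx scale1r scalerBr.
  rewrite opprD addrA; congr (_ + _); rewrite -sumrN; apply: eq_bigr => j ji.
  by rewrite eq_sym (negbTE ji) scale0r sub0r scalerN.
- by rewrite size_W.
- by move=> t; rewrite size_W; apply: IH.
Qed.

Lemma wedge0 w s : wedge w (fun=> 0) s = 0.
Proof.
by elim: w s => [|c w IH] [|[] s] //=; rewrite IH ?scaler0 ?subr0.
Qed.

Lemma wedges_coef_notin l v j s : j \notin l -> size s = size y ->
  wedges_coef l v j s = 0.
Proof.
elim: l s => [|i l IH] s //=; rewrite inE negb_or eq_sym => /andP[/negbTE-> jl] zs.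
rewrite scale0r sub0r (@eq_wedge _ _ (fun=> 0)) ?wedge0 ?oppr0 ?size_W //.
by move=> t; apply: IH.
Qed.

Lemma wedges_support l v s : size s = size y -> (count id s < size l)%N ->
  wedges l v s = 0.
Proof.
elim: l s => [|i l IH] s //= zs ks.
by apply: (@wedge_support _ _ (size l)); rewrite ?size_W // => t; apply: IH.
Qed.

Lemma wedges_sum m (c : 'I_m -> B) (u : 'I_m -> V) l s : size s = size y ->
  wedges l (\sum_i c i *: u i) s = \sum_i c i *: wedges l (u i) s.
Proof.
elim: l s => [|i l IH] s zs /=.
  rewrite /scalar_form; case: has => //.
  by rewrite big1 // => i _; rewrite scaler0.
by rewrite -wedge_sum; apply: eq_wedge; rewrite ?size_W // => t; apply: IH.
Qed.

(* [e_j] wedge [f_1 ... f_n v] has degree above [size y], hence vanishes;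
   contracting it exhibits [y_j f_1 ... f_n v] as a combination of the [x_i]. *)
Lemma scale_wedges l v (j : 'I_(size y)) s : (size y <= size l)%N ->
  size s = size y -> y`_j *: wedges l v s =
  \sum_i x i *: wedge (unit_form j) (wedges_coef l v i) s.
Proof.
move=> yl zs; have zj : size (unit_form j) = size y by rewrite size_mkseq.
rewrite -unit_form_eval -contr_wedge // (@eq_contr _ _ (fun=> 0)) //.
  rewrite contr0 add0r -wedge_sum; apply: eq_wedge; rewrite ?zj // => t.
  exact: contr_wedges.
move=> t zt; apply: (@wedge_support _ _ (size y)); rewrite ?zj //.
  by move=> t' zt' ct'; apply: wedges_support => //; apply: leq_trans yl.
by rewrite ltnS -zt count_size.
Qed.

Section Submodule.
Variable N : {pred V}.
Hypothesis closedN : submod_closed N.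

Let N0 : 0 \in N. Proof. by case: closedN. Qed.
Let ND u v : u \in N -> v \in N -> u + v \in N.
Proof. by move=> uN vN; rewrite -[u]scale1r closedN.2. Qed.
Let NZ c v : v \in N -> c *: v \in N.
Proof. by move=> vN; rewrite -[c *: v]addr0 closedN.2. Qed.
Let NN v : v \in N -> - v \in N.
Proof. by rewrite -scaleN1r; apply: NZ. Qed.

Lemma wedge_closed w al s : (forall t, al t \in N) -> wedge w al s \in N.
Proof.
elim: w al s => [|c w IH] al [|[] s] //= alN; last by apply: IH.
by apply: ND; [apply: NZ | apply/NN/IH].
Qed.

Lemma contr_closed al s : (forall t, al t \in N) -> contr y al s \in N.
Proof.
elim: y al s => [|c y' IH] al [|[] s] //= alN; first by apply/NN/IH.
by apply: ND; [apply: IH | apply: NZ].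
Qed.

Lemma wedges_closed l v s : v \in N -> wedges l v s \in N.
Proof.
move=> vN; elim: l s => [|i l IH] s /=; last exact: wedge_closed.
by rewrite /scalar_form; case: has.
Qed.

Lemma wedges_coef_closed l v j s : v \in N -> wedges_coef l v j s \in N.
Proof.
move=> vN; elim: l s => [|i l IH] s //=.
by apply: ND; [apply/NZ/wedges_closed | apply/NN/wedge_closed].
Qed.

(** In degree 0 only the words with a single [true] contribute, one for each y_j. *)
Lemma contr_degree0 al : (forall t, al t \in N) ->
  exists2 a : nat -> V, (forall j, a j \in N) &
  contr y al (nseq (size y) false) = \sum_(j < size y) y`_j *: a j.
Proof.
elim: y al => [|c y' IH] al alN /=; first by exists (fun=> 0); rewrite ?big_ord0.
have [a aN ->] := IH (fun u => al (false :: u)) (fun u => alN _).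
exists (fun j => if j is j'.+1 then a j' else al (true :: nseq (size y') false)).
  by case.
by rewrite big_ord_recl addrC.
Qed.

Hypothesis relN : forall u : 'I_n -> V, (forall i, u i \in N) ->
  \sum_i x i *: u i = 0 -> forall i, ideal_mul x N (u i).

Lemma koszul_descent z : z \in N ->
  (forall s, size s = size y -> ideal_mul x N (wedges (enum 'I_n) z s)) ->
  ideal_mul (fun j : 'I_(size y) => y`_j) N z.
Proof.
move=> zN top.
(* The invariant of the descent: f_l z is a boundary modulo (x), with witnesses in [N]. *)
pose P l := exists al, exists u : 'I_n -> bitseq -> V,
  [/\ forall s, al s \in N, forall i s, u i s \in N & forall s, size s = size y ->
    wedges l z s = contr y al s + \sum_i x i *: u i s].
have exP l (al : bitseq -> V) : (forall s, al s \in N) ->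
    (forall s, size s = size y -> ideal_mul x N (wedges l z s - contr y al s)) ->
    P l.
  move=> alN H.
  (* Witnesses are chosen word by word; words of the wrong length get 0. *)
  have /choice[u uP] s : exists u : 'I_n -> V, (forall i, u i \in N) /\
      (size s = size y -> wedges l z s - contr y al s = \sum_i x i *: u i).
    have [/H[u uN ->]|] := eqVneq (size s) (size y); first by exists u.
    by move=> /eqP nz; exists (fun=> 0).
  exists al, (fun i s => u s i); split=> // [i s|s zs]; first exact: (uP s).1.
  by rewrite -(uP s).2 // addrC subrK.
(* Applying d to f_i f_l z = d al + sum_j x_j u_j gives sum_j x_j (c_j - d u_j) = 0, with c_j taken
   from [wedges_coef]. As i is not in [l], c_i = f_l z, so [relN] at index i makes f_l z the
   boundary of u_i modulo (x). *)
have step i l : i \notin l -> P (i :: l) -> P l.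
  move=> il [al [u [alN uN eq_u]]]; apply: (exP l (u i)) => // s zs.
  have -> : wedges l z s - contr y (u i) s =
      wedges_coef (i :: l) z i s - contr y (u i) s.
    by rewrite /= eqxx scale1r (@eq_wedge _ _ (fun=> 0)) ?wedge0 ?subr0 ?size_W //
      => t; apply: wedges_coef_notin.
  apply: (relN (u := fun j => wedges_coef (i :: l) z j s - contr y (u j) s)).
    by move=> j; apply: ND; [apply: wedges_coef_closed | apply/NN/contr_closed].
  under eq_bigr do rewrite scalerBr.
  rewrite sumrB -contr_wedges // -contr_sum (eq_contr zs eq_u) contrD contrK add0r.
  exact: subrr.
have {step} : forall l, uniq l -> P l -> P [::].
  by elim=> [|i l IH] //= /andP[il ul] /(step _ _ il)/IH; apply.
move=> /(_ (enum 'I_n) (enum_uniq _)) [].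
  by apply: (exP _ (fun=> 0)) => // s zs; rewrite contr0 subr0; apply: top.
(* For [l] empty, the degree 0 component reads z = d al + sum_i x_i u_i, and each x_i is a
   combination of the y_j. *)
move=> al [u [alN uN /(_ (nseq (size y) false))]]; rewrite size_nseq => /(_ erefl).
set s0 := nseq _ _; have [a aN ->] := contr_degree0 alN.
rewrite /= /scalar_form has_nseq andbF => ->.
exists (fun j => a j + \sum_i (W i)`_j *: u i s0) => [j|].
  by apply: ND => //; elim/big_ind: _ => // i _; apply: NZ.
under [RHS]eq_bigr do rewrite scalerDr scaler_sumr.
rewrite big_split exchange_big /=; congr (_ + _); apply: eq_bigr => i _.
by rewrite xE scaler_suml; apply: eq_bigr => j _; rewrite scalerA mulrC.
Qed.

Lemma koszul_descent_sub z : (size y <= n)%N ->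
  (forall v, v \in N -> ideal_mul x predT v -> ideal_mul x N v) -> z \in N ->
  ideal_mul (fun j : 'I_(size y) => y`_j) predT z ->
  ideal_mul (fun j : 'I_(size y) => y`_j) N z.
Proof.
move=> yn xN zN [u _ zE]; apply: koszul_descent => // s zs.
apply: xN; first exact: wedges_closed.
rewrite zE wedges_sum //; under eq_bigr do rewrite scale_wedges ?size_enum_ord //.
exists (fun i => \sum_(j < size y)
  wedge (unit_form j) (wedges_coef (enum 'I_n) (u j) i) s) => //.
by rewrite exchange_big; apply: eq_bigr => i _; rewrite scaler_sumr.
Qed.

End Submodule.
End Koszul.

(** * Spans and minimal generating sequences *)

Section Span.
Variables (R : comNzRingType) (M : lmodType R).
Implicit Types (N I : {pred M}) (s : seq M).

Lemma submod_sum N n (c : 'I_n -> R) (u : 'I_n -> M) : submod_closed N ->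
  (forall i, u i \in N) -> \sum_i c i *: u i \in N.
Proof.
move=> [N0 ND] uN; elim/big_ind: _ => // [v w vN wN|i _].
  by rewrite -[v]scale1r ND.
by rewrite -[_ *: _]addr0 ND.
Qed.

(** The combinations of [s] form a submodule containing [s]. Testing against submodules avoids
    handling coefficients. *)
Lemma lin_combP s (v : M) : (exists c, v = @lin_comb R M s c) <->
  (forall N, submod_closed N -> {subset s <= N} -> v \in N).
Proof.
split=> [[c ->] N cN sN|]; first by apply: submod_sum => // i; apply/sN/mem_nth.
move=> /(_ (fun u => `[< exists c, u = @lin_comb R M s c >])) H.
apply/asboolP/H; first split.
- apply/asboolP; exists (fun=> 0).
  by rewrite /lin_comb big1 // => i _; rewrite scale0r.
- move=> a u w /asboolP[c ->] /asboolP[d ->]; apply/asboolP.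
  exists (fun i => a * c i + d i); rewrite /lin_comb scaler_sumr -big_split.
  by apply: eq_bigr => i _; rewrite scalerDl scalerA.
move=> u /(nthP 0)[i si <-]; apply/asboolP.
exists (fun j => (j == Ordinal si)%:R).
rewrite /lin_comb (bigD1 (Ordinal si)) //= eqxx scale1r.
rewrite big1 ?addr0 // => j /negbTE->.
by rewrite scale0r.
Qed.

Lemma generatesP s I : generates s I <-> [/\ submod_closed I, {subset s <= I} &
  forall N, submod_closed N -> {subset s <= N} -> {subset I <= N}].
Proof.
split=> [gI|[cI sI minI] v].
  have gI' v : v \in I <->
      forall N, submod_closed N -> {subset s <= N} -> v \in N.
    by split=> [/gI/lin_combP|/lin_combP/gI].
  split=> [|v vs|N cN sN v /gI'/(_ N cN sN)//]; last by apply/gI' => N _; apply.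
  split; first by apply/gI' => N [].
  move=> a u v /gI' uI /gI' vI; apply/gI' => N cN sN.
  by apply: (cN.2); [apply: uI | apply: vI].
split=> [vI|/lin_combP]; last by apply.
by apply/lin_combP => N cN sN; apply: minI.
Qed.

Lemma minimal_generators I : (exists s, generates s I) ->
  exists2 s, generates s I & forall t, generates t I -> (size s <= size t)%N.
Proof.
move=> [s0 g0]; pose p n := `[< exists2 s, generates s I & size s = n >].
have ex_p : exists n, p n by exists (size s0); apply/asboolP; exists s0.
have [n /asboolP[s gs <-] min_n] := ex_minnP ex_p.
by exists s => // t gt; apply/min_n/asboolP; exists t.
Qed.

End Span.

(** * Local rings: units, minimal relations, Nakayama *)

Section Local.
Variable R : comNzRingType.
Hypothesis localR : local_ring R.

Let m := max_ideal R.
Let mP : maximal_ideal m := max_idealP localR.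

Lemma max_ideal_uniq (J : {pred R}) : maximal_ideal J -> J = m.
Proof. by case: localR => J0 [_ u] JP; rewrite -(u _ JP) (u _ mP). Qed.

Lemma max_ideal_closed : submod_closed (m : {pred R^o}).
Proof. by case: mP => [[m0 _ mD] _]; split=> // a x y; apply: mD. Qed.

Lemma max_ideal_not1 : 1 \notin m.
Proof. by case: mP => [[]]. Qed.

(** Zorn's lemma among the proper ideals containing [J]: a maximal one is a maximal ideal, hence the
    unique one. *)
Lemma proper_sub_max (J : {pred R}) : idealr_closed J -> {subset J <= m}.
Proof.
move=> cJ.
pose T := {K : R -> bool |
  `[< idealr_closed (K : {pred R}) /\ {subset J <= K} >]}.
have TP (K : T) : idealr_closed (sval K : {pred R}) /\ {subset J <= sval K}.
  by apply/asboolP; apply: (svalP K).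
pose r (K L : T) := `[< {subset (sval K : {pred R}) <= (sval L : {pred R})} >].
have [|K L P /asboolP KL /asboolP LP|K L /asboolP KL /asboolP LK|C totC|K maxK]
  := @Zorn T r.
- by move=> K; apply/asboolP.
- by apply/asboolP => a /KL/LP.
- case: K L KL LK => [K KT] [L LT] /= KL LK; apply: eq_exist.
  by apply: funext => a; apply/idP/idP => [/KL|/LK].
(* The empty chain is bounded by [J] itself, any other by its union, which stays proper. *)
- have JT : `[< idealr_closed J /\ {subset J <= J} >] by apply/asboolP; split.
  have [[K0 CK0]|noC] := pselect (exists K, C K); last first.
    by exists (exist _ (J : R -> bool) JT) => K CK; case: noC; exists K.
  pose U : R -> bool := fun a => `[< exists2 K, C K & a \in (sval K : {pred R}) >].
  have UT : `[< idealr_closed (U : {pred R}) /\ {subset J <= U} >].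
    apply/asboolP; split; last first.
      by move=> a aJ; apply/asboolP; exists K0 => //; apply: (TP K0).2.
    split.
    + by apply/asboolP; exists K0 => //; case: (TP K0) => [[]].
    + by apply/asboolP => -[K _]; apply/negP; case: (TP K) => [[]].
    + move=> a u v /asboolP[K CK uK] /asboolP[L CL vL]; apply/asboolP.
      case: (totC K L CK CL) => /asboolP KL.
        by exists L => //; case: (TP L) => [[_ _ D] _]; apply: D => //; apply: KL.
      by exists K => //; case: (TP K) => [[_ _ D] _]; apply: D => //; apply: KL.
  exists (exist _ U UT) => K CK; apply/asboolP => a aK.
  by apply/asboolP; exists K.
have [cK JK] := TP K; suff <- : (sval K : {pred R}) = m by [].
apply: max_ideal_uniq; split=> // L cL KL.
have LT : `[< idealr_closed L /\ {subset J <= L} >].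
  by apply/asboolP; split=> // a /JK/KL.
by have <- := maxK (exist _ (L : R -> bool) LT) (asboolT KL).
Qed.

(** Otherwise the multiples of a form a proper ideal, which lies in m. *)
Lemma local_unit (a : R) : a \notin m -> exists b, b * a = 1.
Proof.
move=> am; apply: contrapT => nu; move/negP: am; apply.
pose J : {pred R} := fun c => `[< exists b, c = b * a >].
apply: (@proper_sub_max J); last by apply/asboolP; exists 1; rewrite mul1r.
split; first by apply/asboolP; exists 0; rewrite mul0r.
  by apply/asboolP => -[b E]; apply: nu; exists b.
move=> c _ _ /asboolP[b ->] /asboolP[d ->]; apply/asboolP; exists (c * b + d).
by rewrite mulrDl mulrA.
Qed.

Variable M : lmodType R.

(* A relation with an invertible coefficient would make one of the generators
   redundant. *)
Lemma minimal_relation (I : {pred M}) s (c : 'I_(size s) -> R) :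
  generates s I -> (forall t, generates t I -> (size s <= size t)%N) ->
  \sum_(i < size s) c i *: s`_i = 0 -> forall i, c i \in m.
Proof.
move=> /generatesP[cI sI minI] min_s c0 i.
apply: contrapT => /negP/local_unit[b bc].
pose t := [seq s`_j | j : 'I_(size s) <- rem i (enum 'I_(size s))].
suff /min_s : generates t I.
  by rewrite size_map size_rem ?mem_enum // size_enum_ord leqNgt prednK ?leqnn //;
    apply: leq_ltn_trans (ltn_ord i).
have tj (j : 'I_(size s)) : j != i -> s`_j \in t.
  move=> ji; apply/mapP; exists j => //.
  by rewrite mem_rem_uniq ?enum_uniq // inE ji mem_enum.
apply/generatesP; split=> // [v /mapP[j _ ->]|N cN tN]; first by apply/sI/mem_nth.
apply: minI => // v /(nthP 0)[k ks <-].
have [E|/tj/tN//] := eqVneq (Ordinal ks) i.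
rewrite -[k]/(val (Ordinal ks)) E -[s`_i]scale1r -bc -scalerA.
suff -> : c i *: s`_i = - (\sum_(j | j != i) c j *: s`_j).
  rewrite scalerN -scaleNr -[_ *: _]addr0; apply: cN.2 cN.1.
  elim/big_ind: _ => [|u w uN wN|j /tj/tN jN]; first by case: cN.
    by rewrite -[u]scale1r cN.2.
  by rewrite -[_ *: _]addr0; apply: cN.2 cN.1.
by move: c0; rewrite (bigD1 i) //= => /eqP; rewrite addr_eq0 => /eqP.
Qed.

(** The first member v0 of a minimal generating sequence would lie in (x) I, giving a relation whose
    coefficient at v0 is 1 minus an element of m. Minimality forbids this, so the sequence is
    empty. *)
Lemma nakayama (I : {pred M}) n (x : 'I_n -> R) : (forall i, x i \in m) ->
  (exists s, generates s I) -> (forall v, v \in I -> ideal_mul x I v) ->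
  forall v, v \in I -> v = 0.
Proof.
move=> xm /minimal_generators[s gs min_s] Ix v.
have [cI sI minI] := (generatesP _ _).1 gs.
case: s gs min_s sI minI => [|v0 s] gs min_s sI minI.
  move=> vI; suff : v \in (fun w => w == 0) by move/eqP.
  apply: minI vI => //; split; first exact: eqxx.
  by move=> a u w /eqP-> /eqP->; rewrite -topredE /= scaler0 addr0 eqxx.
have [u uI] := Ix v0 (sI _ (mem_head _ _)).
have /choice[c cE] i := (gs (u i)).1 (uI i).
pose d k := (k == ord0)%:R - \sum_i x i * c i k.
move=> v0E; have d0 : \sum_(k < size (v0 :: s)) d k *: (v0 :: s)`_k = 0.
  under eq_bigr do rewrite scalerBl.
  rewrite sumrB (_ : \sum_k _ = v0); last first.
    rewrite (bigD1 ord0) //= scale1r big1 ?addr0 // => k /negbTE->.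
    by rewrite scale0r.
  apply/eqP; rewrite subr_eq0 {1}v0E; apply/eqP.
  under [RHS]eq_bigr do rewrite scaler_suml.
  rewrite exchange_big; apply: eq_bigr => i _; rewrite cE scaler_sumr.
  by apply: eq_bigr => k _; rewrite scalerA.
have /= := minimal_relation gs min_s d0 ord0.
have [cm0 cm] := max_ideal_closed.
have xm0 : \sum_i x i * c i ord0 \in m.
  elim/big_ind: _ => // [a b am bm|i _]; first by rewrite -[a]mul1r cm.
  by rewrite mulrC -[_ * _]addr0 cm.
rewrite /d eqxx => dm; have /negP := max_ideal_not1; case.
by rewrite -[1](subrK (\sum_i x i * c i ord0)) -[1 - _]mul1r cm.
Qed.

End Local.

(** * Submodules of free modules over a Noetherian ring *)

Lemma noetherian_rV (R : comNzRingType) n (N : {pred 'rV[R]_n}) :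
  noetherian R -> submod_closed N -> exists s, generates s N.
Proof.
(* Induction on the number k of leading coordinates allowed to be nonzero: lifts of generators of
   the ideal of values of the last one, together with generators of its kernel, generate. *)
move=> nR cN; suff H k (K : {pred 'rV[R]_n}) : submod_closed K ->
    (forall v, v \in K -> forall i : 'I_n, (k <= i)%N -> v 0 i = 0) ->
    exists s, generates s K.
  by apply: (H n) => // v _ i; rewrite leqNgt ltn_ord.
elim: k K {N cN} => [|k IH] K cK K0.
  exists [::]; apply/generatesP; split=> // N cN _ v /K0 v0.
  by have -> : v = 0; [apply/rowP => i; rewrite mxE v0 | case: cN].
have [kn|nk] := ltnP k n; last first.
  by apply: IH cK _ => v _ i; rewrite leqNgt (leq_trans (ltn_ord i) nk).
pose j := Ordinal kn.
pose I : {pred R^o} := fun a => `[< exists2 v, v \in K & v 0 j = a >].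
have [|s /generatesP[cI sI minI]] := nR I.
  split; first by apply/asboolP; exists 0; rewrite ?mxE //; case: cK.
  move=> a _ _ /asboolP[u uK <-] /asboolP[v vK <-]; apply/asboolP.
  by exists (a *: u + v); rewrite ?mxE //; apply: cK.2.
pose L : {pred 'rV[R]_n} := fun v => (v \in K) && (v 0 j == 0).
have [||t /generatesP[cL tL minL]] := IH L.
- split; first by rewrite -topredE /= /L mxE eqxx andbT; case: cK.
  move=> a u v /andP[uK /eqP u0] /andP[vK /eqP v0].
  by rewrite -topredE /= /L !mxE u0 v0 mulr0 addr0 eqxx andbT; apply: cK.2.
- move=> v /andP[vK /eqP v0] i; rewrite leq_eqVlt => /orP[/eqP ki|/K0]; last exact.
  by rewrite -v0; congr (v 0 _); apply: val_inj.
have /choice[lift liftP] (a : R) : exists v, a \in I -> v \in K /\ v 0 j = a.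
  have [/asboolP[v vK va]|aI] := boolP (a \in I); last by exists 0.
  by exists v.
exists (map lift s ++ t); apply/generatesP; split=> //.
  by move=> v; rewrite mem_cat => /orP[/mapP[a /sI/liftP[? _] ->]|/tL/andP[]].
move=> N cN stN v vK.
have tN : {subset L <= N}.
  by apply: minL => // w wt; apply: stN; rewrite mem_cat wt orbT.
(* The values reached inside [N] include the generators of [I], so some w in [N] agrees with v at j,
   and v - w lies in [L]. *)
pose J : {pred R^o} := fun a => `[< exists w, [/\ w \in N, w \in K & w 0 j = a] >].
have /asboolP[w [wN wK wv]] : v 0 j \in J.
  apply: minI; last by apply/asboolP; exists v.
    split; first by apply/asboolP; exists 0; rewrite mxE; case: cN cK => ? _ [? _].
    move=> a _ _ /asboolP[u [uN uK <-]] /asboolP[w [wN wK <-]]; apply/asboolP.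
    by exists (a *: u + w); rewrite !mxE; split; [apply: cN.2 | apply: cK.2 |].
  move=> a sa; have [aK aE] := liftP a (sI a sa).
  apply/asboolP; exists (lift a); split=> //.
  by apply: stN; rewrite mem_cat map_f.
rewrite -[v](subrK w) -[v - w]scale1r; apply: cN.2 => //; apply: tN.
apply/andP; split; last by rewrite !mxE wv subrr.
by rewrite addrC -scaleN1r; apply: cK.2.
Qed.

(** * Additive maps, submodules as modules, generated ideals *)

Lemma zmod_morphism0 (U V : zmodType) (g : U -> V) : zmod_morphism g -> g 0 = 0.
Proof. by move=> gB; rewrite -(subrr 0) gB subrr. Qed.

Lemma zmod_morphism_sum (U V : zmodType) (g : U -> V) : zmod_morphism g ->
  forall n (F : 'I_n -> U), g (\sum_i F i) = \sum_i g (F i).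
Proof.
move=> gB n F; apply: big_morph; last exact: zmod_morphism0.
move=> a b; rewrite -[b in LHS]opprK gB -[- b]sub0r gB zmod_morphism0 //.
by rewrite sub0r opprK.
Qed.

Section Submodule.
Variables (R : comNzRingType) (V : lmodType R) (N : {pred V}).

(** The closedness proof is an argument of the type, so that the module structure can be attached to
    it. The ideal m thus becomes a module to which flatness applies. *)
Definition submodule of submod_closed N : Type := {v : V | v \in N}.

Variable cN : submod_closed N.

HB.instance Definition _ := SubChoice.on (submodule cN).
HB.instance Definition _ := GRing.SubChoice_isSubLmodule.Build R V
  (fun v => v \in N) (submodule cN) (GRing.submod_closed_semi cN).

End Submodule.

Section IdealGen.
Variables (R : comNzRingType) (n : nat) (x : 'I_n -> R).

Definition ideal_gen : {pred R} :=
  fun a => `[< ideal_mul x predT (a : R^o) >].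

Lemma ideal_genM a b : a \in ideal_gen -> a * b \in ideal_gen.
Proof.
move=> /asboolP[u _ ->]; apply/asboolP; exists (fun i => u i * b) => //.
by rewrite mulr_suml; apply: eq_bigr => i _; rewrite /GRing.scale /= mulrA.
Qed.

Lemma ideal_gen_mem i : x i \in ideal_gen.
Proof.
apply/asboolP; exists (fun j => (j == i)%:R) => //.
rewrite (bigD1 i) //= eqxx big1 ?addr0 => [|j /negbTE->]; last by rewrite scaler0.
by rewrite /GRing.scale /= mulr1.
Qed.

Lemma ideal_gen_closed : zmod_closed ideal_gen.
Proof.
split=> [|a b /asboolP[u _ ->] /asboolP[v _ ->]]; apply/asboolP.
  by exists (fun=> 0) => //; rewrite big1 // => i _; rewrite scaler0.
exists (fun i => u i - v i) => //; rewrite -sumrB.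
by apply: eq_bigr => i _; rewrite scalerBr.
Qed.

HB.instance Definition _ :=
  GRing.isZmodClosed.Build R ideal_gen ideal_gen_closed.

End IdealGen.

(** * Relations over flat and free modules *)

Lemma sumr_ideal_gen (R : comNzRingType) n (x : 'I_n -> R) (c : 'I_n -> R) :
  \sum_i c i * x i \in ideal_gen x.
Proof.
by apply: rpred_sum => i _; rewrite mulrC ideal_genM // ideal_gen_mem.
Qed.

(* Injectivity of [m (x) B -> A (x) B] kills [\sum_i x_i (x) b_i]; the
   coordinate maps [m -> A / m] send it to the classes of the [b_i]. *)
Lemma flat_relation (A B : comNzRingType) (phi : {rmorphism A -> B})
    (s : seq A^o) (b : 'I_(size s) -> B) :
  local_ring A -> flat_morphism phi -> generates s (max_ideal A) ->
  (forall t : seq A^o, generates t (max_ideal A) -> (size s <= size t)%N) ->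
  \sum_(i < size s) phi s`_i * b i = 0 ->
  forall i, b i \in ideal_gen (fun j : 'I_(size s) => phi s`_j).
Proof.
move=> locA flatB gs min_s b0 i.
set Q := ideal_gen _; pose m := max_ideal A.
have cm : submod_closed (m : {pred A^o}) := max_ideal_closed locA.
have sm (j : 'I_(size s)) : (s`_j : A^o) \in m.
  by case/generatesP: gs => _ sI _; apply/sI/mem_nth.
have mQ a : a \in m -> phi a \in Q.
  move=> /gs[c ->]; rewrite /lin_comb rmorph_sum.
  under eq_bigr do rewrite rmorphM; exact: sumr_ideal_gen.
(* [lam] picks coordinates on m without any linearity; minimality determines them modulo m. *)
have /choice[lam lamE] (v : A^o) : exists c : 'I_(size s) -> A,
    v \in m -> v = \sum_(j < size s) c j *: s`_j.
  have [/gs[c ->]|vm] := boolP (v \in m); first by exists c.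
  by exists (fun=> 0).
have lam_uniq c v : v \in m -> v = \sum_(j < size s) c j *: s`_j :> A^o ->
    phi (lam v i) - phi (c i) \in Q.
  move=> /lamE vE cE; rewrite -rmorphB; apply: mQ.
  apply: (minimal_relation locA gs min_s (c := fun j => lam v j - c j)).
  by under eq_bigr do rewrite scalerBl; rewrite sumrB -vE -cE subrr.
(* The coordinate map m -> A / m enters already tensored with B, as a map into B / Q. *)
pose P := Quotient.quot Q.
pose f (y : restrict phi B^o) (v : submodule cm) : P :=
  \pi_P ((y : B) * phi (lam (\val v) i)).
have piE (y z : B) : y - z \in Q -> \pi_P y = \pi_P z.
  by rewrite Quotient.idealrBE => /eqP.
have f_bal : balanced f.
  split=> [y z v|y v w|a y v]; rewrite /f.
  - by rewrite -raddfD /= mulrDl.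
  - rewrite -raddfD /=; apply: piE; rewrite -mulrDr -mulrBr mulrC ideal_genM //.
    rewrite -rmorphD; apply: (lam_uniq (fun j => lam (\val v) j + lam (\val w) j)).
      exact: (valP (v + w)).
    under eq_bigr do rewrite scalerDl.
    by rewrite big_split -!lamE //; [apply: valP | apply: valP].
  - apply: piE; rewrite -opprB rpredN.
    have -> : (a *: y : B) = y * phi a by rewrite mulrC.
    rewrite -mulrA -mulrBr mulrC ideal_genM // -rmorphM.
    apply: (lam_uniq (fun j => a * lam (\val v) j)); first exact: (valP (a *: v)).
    under eq_bigr do rewrite -scalerA.
    by rewrite -scaler_sumr -lamE //; apply: valP.
pose xs (j : 'I_(size s)) : submodule cm := exist _ (s`_j : A^o) (sm j).
pose t := \sum_j tens (b j : restrict phi B^o) (xs j).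
(* Over [A^o], each tensor of b_j with s_j is that of phi(s_j) b_j with 1, so the image of [t] comes
   from the vanishing sum. *)
have t0 : t = 0.
  apply: (flatB _ A^o (\val : {linear submodule cm -> A^o}) val_inj).
  have [r1 r2 r3] := tens_balanced (restrict phi B^o) A^o.
  have u_bal : balanced (fun (y : restrict phi B^o) (v : submodule cm) =>
      tens y (\val v : A^o)).
    by split=> *; rewrite ?linearD ?linearZ.
  rewrite /tensor_map /t !(zmod_morphism_sum (tensor_lift_is_additive u_bal)).
  rewrite (zmod_morphism0 (tensor_lift_is_additive u_bal)).
  have tensB : zmod_morphism (fun y : restrict phi B^o => tens y (1 : A^o)).
    by move=> y z; apply/eqP; rewrite eq_sym subr_eq -r1 subrK.
  under eq_bigr => j _.
    rewrite tensor_liftE // /= -[s`_j : A^o]mulr1 -/(s`_j *: (1 : A^o)) -r3.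
    over.
  rewrite -(zmod_morphism_sum tensB) (_ : \sum_j _ = 0) ?(zmod_morphism0 tensB) //.
have : tensor_lift f t = \pi_P 0.
  by rewrite t0 (zmod_morphism0 (tensor_lift_is_additive f_bal)) raddf0.
rewrite /t (zmod_morphism_sum (tensor_lift_is_additive f_bal)).
under eq_bigr do rewrite tensor_liftE //.
rewrite /f -raddf_sum /= => /eqP; rewrite -Quotient.idealrBE subr0 => sumQ.
(* Modulo Q, the coordinate of s_j at i is 1 if j = i and 0 otherwise, so [sumQ] reduces to b_i. *)
rewrite -[b i](subrK (\sum_j b j * phi (lam s`_j i))) rpredD // -opprB rpredN.
rewrite [\sum_j _](bigD1 i) //= addrAC rpredD //; last first.
  apply: rpred_sum => j ji; rewrite mulrC ideal_genM //.
  have := lam_uniq (fun k => (k == j)%:R) _ (sm j).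
  rewrite eq_sym (negbTE ji) rmorph0 subr0; apply.
  rewrite (bigD1 j) //= eqxx scale1r big1 ?addr0 // => k /negbTE->.
  by rewrite scale0r.
rewrite -[X in _ - X]mulr1 -mulrBr mulrC ideal_genM //.
have := lam_uniq (fun k => (k == i)%:R) _ (sm i); rewrite eqxx rmorph1; apply.
rewrite (bigD1 i) //= eqxx scale1r big1 ?addr0 // => k /negbTE->.
by rewrite scale0r.
Qed.

(* The equational criterion for flatness, for a free module. *)
Lemma free_relation (R : comNzRingType) (M : lmodType R) n (x : 'I_n -> R)
    (w : 'I_n -> M) : free_module M -> \sum_i x i *: w i = 0 ->
  exists k (e : 'I_k -> M) (a : 'I_n -> 'I_k -> R),
    (forall i, w i = \sum_j a i j *: e j) /\ forall j, \sum_i x i * a i j = 0.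
Proof.
move=> [X [genX indX]] xw.
have /choice[S SP] i := genX (w i).
(* Pooling the basis vectors without repetition lets linear independence apply. *)
pose e := undup (flatten [seq S i | i <- enum 'I_n]).
have eX : {in e, forall v, X v}.
  move=> v; rewrite mem_undup => /flatten_mapP[i _ vS].
  by case: (SP i) => c [SX _]; apply: SX.
have /choice[a aE] i : exists c, w i = @lin_comb R M e c.
  apply/lin_combP => N cN eN; have [c [_ wE]] := SP i.
  apply: (lin_combP (S i) (w i)).1 cN _; first by exists c.
  move=> v vS; apply: eN; rewrite mem_undup; apply/flatten_mapP.
  by exists i; rewrite ?mem_enum.
exists (size e), (fun j => e`_j), a; split=> // j.
apply: (indX e (fun j => \sum_i x i * a i j)) => //; first exact: undup_uniq.
rewrite /lin_comb; under eq_bigr do rewrite scaler_suml.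
rewrite exchange_big -[RHS]xw; apply: eq_bigr => i _.
by rewrite aE scaler_sumr; apply: eq_bigr => k _; rewrite scalerA.
Qed.

Lemma relation_rV (R : comNzRingType) n (x : 'I_n -> R) d :
  (forall b : 'I_n -> R, \sum_i x i * b i = 0 -> forall i, b i \in ideal_gen x) ->
  forall u : 'I_n -> 'rV[R]_d, \sum_i x i *: u i = 0 ->
  forall i, ideal_mul x predT (u i).
Proof.
move=> relx u u0 i.
have /choice[c cE] k : exists c : 'I_n -> R, u i 0 k = \sum_j x j * c j.
  have /relx/(_ i)/asboolP[c _ ->] : \sum_i x i * u i 0 k = 0; last by exists c.
  by have := congr1 (fun v : 'rV_d => v 0 k) u0; rewrite summxE mxE => {2}<-;
    apply: eq_bigr => j _; rewrite mxE.
exists (fun j => \row_k c k j) => //; apply/rowP => k; rewrite cE summxE.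
by apply: eq_bigr => j _; rewrite !mxE.
Qed.

(** Coefficients on distinct members of [s] are moved to a row through their positions in [s]; these
    are distinct, so no coefficients merge. *)
Lemma independent_free (R : comNzRingType) (M : lmodType R) (s : seq M) :
  generates s predT ->
  (forall v : 'rV[R]_(size s), \sum_i v 0 i *: s`_i = 0 -> v = 0) ->
  free_module M.
Proof.
move=> gs ind; exists (fun v => v \in s); split=> [v|t c ut ts c0 k].
  by have [c vE] := (gs v).1 isT; exists s, c; split.
have idx (j : 'I_(size t)) : (index (t`_j)%R s < size s)%N.
  by rewrite index_mem; apply/ts/mem_nth.
pose f j := Ordinal (idx j).
have f_nth j : s`_(f j) = t`_j by rewrite nth_index //; apply/ts/mem_nth.
have f_inj : injective f.
  move=> i j /(congr1 (fun i : 'I_(size s) => s`_i)); rewrite !f_nth.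
  by move=> /eqP; rewrite nth_uniq // => /eqP/val_inj.
pose v : 'rV[R]_(size s) := \sum_j c j *: delta_mx 0 (f j).
have v0 i : v 0 i = \sum_j c j * (i == f j)%:R.
  by rewrite summxE; apply: eq_bigr => j _; rewrite !mxE eqxx.
have -> : c k = v 0 (f k).
  rewrite v0 (bigD1 k) //= eqxx mulr1 big1 ?addr0 // => j jk.
  by rewrite (inj_eq f_inj) eq_sym (negbTE jk) mulr0.
rewrite (ind v) ?mxE //; rewrite -[RHS]c0 /lin_comb.
under eq_bigr do rewrite v0 scaler_suml.
rewrite exchange_big; apply: eq_bigr => j _.
rewrite (bigD1 (f j)) //= eqxx mulr1 nth_index; last exact/ts/mem_nth.
by rewrite big1 ?addr0 // => i /negbTE->; rewrite mulr0 scale0r.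
Qed.

Theorem corollary1p3 (A B : comNzRingType) (phi : {rmorphism A -> B})
  (M : lmodType B) :
  noetherian A -> local_ring A ->
  noetherian B -> local_ring B ->
  local_morphism phi -> flat_morphism phi ->
  (edim B <= edim A)%N ->
  finite_type M -> free_module (restrict phi M) ->
  free_module M /\ edim A = edim B.
Proof.
move=> noA locA noB locB locphi flatphi leBA finM freeM.
have [[s gs sE] min_s] := edimP noA locA; rewrite -sE in min_s.
have [[y gy yE] _] := edimP noB locB.
rewrite -sE -yE in leBA *; set n := size s in leBA *.
pose x (i : 'I_n) : B := phi s`_i.
have relx (b : 'I_n -> B) : \sum_i x i * b i = 0 -> forall i, b i \in ideal_gen x.
  exact: flat_relation.
have ymax (j : 'I_(size y)) : (y`_j : B) \in max_ideal B.
  by case/generatesP: gy => _ sI _; apply/sI/mem_nth.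
have maxy b : b \in max_ideal B ->
    exists c : 'I_(size y) -> B, b = \sum_j c j * y`_j by move=> /gy.
have /choice[c cE] i : exists c, x i = \sum_(j < size y) c j * y`_j.
  apply/maxy/locphi; case/generatesP: gs => _ sI _; apply/sI/mem_nth/ltn_ord.
(* The default 0 is never reached below [size y]. *)
pose W i := mkseq (fun j => if insub j is Some j' then c i j' else 0) (size y).
have size_W i : size (W i) = size y by rewrite size_mkseq.
have xE i : x i = \sum_(j < size y) (W i)`_j * y`_j.
  by rewrite cE; apply: eq_bigr => j _; rewrite nth_mkseq // valK.
split; last first.
  apply/eqP; rewrite eqn_leq leBA andbT leqNgt; apply/negP => lt_yn.
  have closedT : submod_closed (predT : {pred B^o}) by split.
  have [] := koszul_descent size_W xE closedT _ (z := 1 : B^o) isT.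
  - by move=> u _ u0 i; have /asboolP := relx u u0 i.
  - move=> t zt; rewrite (wedges_support size_W) ?size_enum_ord //; last first.
      by rewrite (leq_ltn_trans (count_size _ _)) // zt.
    by exists (fun=> 0) => //; rewrite big1 // => i _; rewrite scaler0.
  move=> u _ E; have /negP := max_ideal_not1 locB; apply; rewrite E.
  have cB := max_ideal_closed locB.
  under eq_bigr do rewrite [_ *: _]mulrC.
  exact: (submod_sum (M := B^o)).
have [t gt min_t] := minimal_generators finM.
apply: (independent_free gt).
pose pi (v : 'rV[B]_(size t)) : M := \sum_i v 0 i *: t`_i.
have piD a u v : pi (a *: u + v) = a *: pi u + pi v.
  rewrite /pi scaler_sumr -big_split; apply: eq_bigr => i _.
  by rewrite !mxE scalerDl scalerA.
pose N : {pred 'rV[B]_(size t)} := fun v => pi v == 0.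
have pi0 : pi 0 = 0 by rewrite /pi big1 // => i _; rewrite mxE scale0r.
have closedN : submod_closed N.
  split; first exact/eqP.
  by move=> a u v /eqP u0 /eqP v0; apply/eqP; rewrite piD u0 v0 scaler0 addr0.
have pi_sum m (a : 'I_m -> B) (u : 'I_m -> 'rV_(size t)) :
    pi (\sum_i a i *: u i) = \sum_i a i *: pi (u i).
  elim/big_rec2: _ => [|i z w _ <-]; [exact: pi0 | exact: piD].
have pi_surj w : exists v, pi v = w.
  have [a ->] := (gt w).1 isT; exists (\row_i a i).
  by apply: eq_bigr => i _; rewrite mxE.
(* Freeness over A writes pi(u_i) = sum_j a_ij e_j with sum_i s_i a_ij = 0. Subtracting lifts of
   these sums moves the u_i into [N] without changing sum_i x_i u_i. *)
have xN v : v \in N -> ideal_mul x predT v -> ideal_mul x N v.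
  move=> /eqP vN [u _ vE].
  have [|k [e [a [uE a0]]]] := @free_relation A (restrict phi M) n
      (fun i => s`_i) (fun i => pi (u i)) freeM.
    by rewrite -[RHS]vN vE pi_sum.
  have /choice[e' e'E] j := pi_surj (e j).
  exists (fun i => u i - \sum_j phi (a i j) *: e' j) => [i|].
    apply/eqP; rewrite -[u i - _]addrC -scaleN1r piD pi_sum uE scaleN1r.
    by apply/eqP; rewrite addrC subr_eq0; apply/eqP/eq_bigr => j _; rewrite e'E.
  under eq_bigr do rewrite scalerBr scaler_sumr.
  rewrite sumrB -vE exchange_big big1 ?subr0 // => j _.
  under eq_bigr do rewrite scalerA -rmorphM.
  by rewrite -scaler_suml -rmorph_sum a0 rmorph0 scale0r.
suff N0 v : v \in N -> v = 0 by move=> v /eqP /N0.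
apply: (nakayama locB ymax) => [|{}v].
  exact: noetherian_rV.
move=> vN; apply: (koszul_descent_sub size_W xE closedN) => //.
  move=> u uN u0 i; apply: xN => //; exact: relation_rV relx _ u0 i.
(* An element of [N] is a relation among minimal generators, so its coordinates lie in the maximal
   ideal, that is, in (y). *)
have vmax k : v 0 k \in max_ideal B.
  by apply: (minimal_relation locB gt min_t (c := fun k => v 0 k)); apply/eqP.
have /choice[d dE] k := maxy _ (vmax k).
exists (fun j => \row_k d k j) => //; apply/rowP => k; rewrite dE summxE.
by apply: eq_bigr => j _; rewrite !mxE mulrC.
Qed.
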